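(* Let $x\in\mathbb{C}$ and let $\sqrt{9x^2-1}$ denote a fixed complex square root of $9x^2-1$. Then for every integer $n\geq 0$, $$\sum_{k=0}^n \binom{n}{k}\bigl(12x\sqrt{9x^2-1}\bigr)^{n-k} B^*_{2k}(x)\,B_{n-k}(x) = 6nx\bigl(18x^2-1+6x(2x-1)\sqrt{9x^2-1}\bigr)^{n-1}.$$
   Context: The Bernoulli polynomials $B_n(x)$ are defined by $\sum_{n\ge0}B_n(x)\frac{z^n}{n!}=\frac{ze^{xz}}{e^z-1}$ ($|z|<2\pi$). The balancing polynomials are defined by $B^*_0(x)=0$, $B^*_1(x)=1$, $B^*_n(x)=6xB^*_{n-1}(x)-B^*_{n-2}(x)$ for $n\ge2$. For $n=0$ the right-hand side, which carries the factor $n$, is interpreted as $0$. *)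

(* Defs.v *)
(* Stdlib world: the complex numbers, series and norms are Coquelicot's. *)
From Stdlib Require Import Reals Factorial.
From Coquelicot Require Import Coquelicot.
Open Scope C_scope.

Definition Cexp (z : C) : C :=
  RtoC (exp (Re z)) * (RtoC (cos (Im z)) + Ci * RtoC (sin (Im z))).

(* The quotient z e^(xz) / (e^z - 1) has a removable singularity at z = 0,
   where it takes the value 1. *)
Definition bernoulli_gf (x z : C) : C :=
  if Ceq_dec z 0 then 1 else z * Cexp (x * z) / (Cexp z - 1).

(* B n x is the value at x of the n-th Bernoulli polynomial. The expansion at
   z near 0 determines every B n x uniquely, and forces x |-> B n x to be a
   polynomial function of degree n. Convergence is in the complex norm. *)
Definition is_bernoulli_polynomials (B : nat -> C -> C) : Prop :=
  forall x z : C, (Cmod z < 2 * PI)%R ->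
    @is_series C_AbsRing C_NormedModule
      (fun n : nat => B n x * (z ^ n / RtoC (INR (fact n))))
      (bernoulli_gf x z).

Fixpoint balancing (n : nat) (x : C) {struct n} : C :=
  match n with
  | O => 0
  | S m =>
      match m with
      | O => 1
      | S p => 6 * x * balancing m x - balancing p x
      end
  end.

(* Only meaningful for k <= n: Binomial.C is n! / (k! (n - k)!) with truncated
   subtraction. *)
Definition Cbinom (n k : nat) : C := RtoC (Binomial.C n k).

(* Main.v *)
Require Import Defs.
From Stdlib Require Import Reals Lra Lia Factorial.
From Coquelicot Require Import Coquelicot.
Open Scope C_scope.

(* Multiplying the Bernoulli generating function by e^z - 1 and comparing
   coefficients gives sum_(k < n) C(n,k) B_k(x) = n x^(n-1). In terms of
   binomial convolutions this says that, for
   P_n(t) = sum_k C(n,k) w^(n-k) t^k B_(n-k)(x), one has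
   P_n(t + w) - P_n(t) = n w (t + w x)^(n-1).
   Since (3x + s)(3x - s) = 1, the Binet formula reads
   2 s B*_(2k) = a^k - b^k with a, b = (3x +- s)^2 and a - b = 12 x s, so for
   s <> 0 the theorem is this difference equation at t = b, w = 12 x s, divided
   by 2 s. For s = 0 only the term k = n survives, and B*_(2n) = 6 n x. *)

(* [sum_n] ends in the carrier of a canonical structure, a type at which [ring]
   does not recognise [C]. *)
Ltac at_C := match goal with |- @eq _ ?a ?b => change (@eq C a b) end.
Ltac Cring := at_C; ring.
Ltac Cfield := at_C; field.

(** * Finite complex sums and Cauchy products of sequences *)

Lemma Cplus_sum_n (u v : nat -> C) (n : nat) :
  sum_n (fun k => u k + v k) n = sum_n u n + sum_n v n.
Proof. exact (sum_n_plus u v n). Qed.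

Lemma Cmult_sum_n_l (c : C) (u : nat -> C) (n : nat) :
  sum_n (fun k => c * u k) n = c * sum_n u n.
Proof. exact (sum_n_mult_l c u n). Qed.

Lemma Cmult_sum_n_r (c : C) (u : nat -> C) (n : nat) :
  sum_n (fun k => u k * c) n = sum_n u n * c.
Proof. exact (sum_n_mult_r c u n). Qed.

Lemma Csum_Sn (u : nat -> C) (n : nat) :
  sum_n u (S n) = sum_n u n + u (S n).
Proof. exact (sum_Sn u n). Qed.

Lemma Csum_Sn_l (u : nat -> C) (n : nat) :
  sum_n u (S n) = u O + sum_n (fun k => u (S k)) n.
Proof.
  induction n as [|n IH].
  - rewrite Csum_Sn, !sum_O; reflexivity.
  - rewrite Csum_Sn, IH, (Csum_Sn (fun k => u (S k))). Cring.
Qed.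

(** Both sides sum [f j i] over [j + i <= n], by antidiagonals and by rows. From [n] to [S n], each
    old row gains its entry on the new antidiagonal, and one new row with a single entry appears. *)
Lemma Csum_n_triangle (f : nat -> nat -> C) (n : nat) :
  sum_n (fun k => sum_n (fun j => f j (k - j)%nat) k) n
  = sum_n (fun j => sum_n (fun i => f j i) (n - j)%nat) n.
Proof.
  induction n as [|n IH].
  - rewrite !sum_O; reflexivity.
  - rewrite Csum_Sn, IH, !Csum_Sn, Nat.sub_diag, sum_O, Cplus_assoc.
    f_equal. rewrite <- Cplus_sum_n. apply sum_n_ext_loc; intros j Hj.
    replace (S n - j)%nat with (S (n - j)) by lia.
    now rewrite Csum_Sn.
Qed.

(** Cauchy product: a binomial convolution takes this form once every sequence is divided by
    factorials. *)
Definition conv (a b : nat -> C) (n : nat) : C :=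
  sum_n (fun k => a k * b (n - k)%nat) n.

Lemma conv_ext (a a' b b' : nat -> C) (n : nat) :
  (forall k, a k = a' k) -> (forall k, b k = b' k) ->
  conv a b n = conv a' b' n.
Proof.
  intros Ha Hb; apply sum_n_ext; intros k; now rewrite Ha, Hb.
Qed.

Lemma conv_assoc (a b c : nat -> C) (n : nat) :
  conv (conv a b) c n = conv a (conv b c) n.
Proof.
  unfold conv.
  transitivity (sum_n (fun k => sum_n (fun j =>
      a j * b (k - j)%nat * c (n - j - (k - j))%nat) k) n).
  - apply sum_n_ext_loc; intros k Hk. rewrite <- Cmult_sum_n_r.
    apply sum_n_ext_loc; intros j Hj. do 2 f_equal; lia.
  - rewrite (Csum_n_triangle (fun j i => a j * b i * c (n - j - i)%nat)).
    apply sum_n_ext_loc; intros j Hj. rewrite <- Cmult_sum_n_l.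
    apply sum_n_ext; intros i. Cring.
Qed.

Lemma conv_comm (a b : nat -> C) (n : nat) : conv a b n = conv b a n.
Proof.
  revert a b; induction n as [|n IH]; intros a b; unfold conv.
  - rewrite !sum_O; apply Cmult_comm.
  (* Split off the last term on the left and the first on the right, which agree up to order; the
     induction hypothesis, for arbitrary sequences, reverses the remaining sum. *)
  - rewrite Csum_Sn, Csum_Sn_l, Nat.sub_diag, Nat.sub_0_r.
    change (sum_n (fun k => b (S k) * a (S n - S k)%nat) n)
      with (conv (fun k => b (S k)) a n).
    rewrite <- IH. unfold conv at 1.
    rewrite (Cmult_comm (a (S n))), Cplus_comm. f_equal.
    apply sum_n_ext_loc; intros k Hk. do 2 f_equal; lia.
Qed.

Lemma conv_plus_r (a b c : nat -> C) (n : nat) :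
  conv a (fun k => b k + c k) n = conv a b n + conv a c n.
Proof.
  unfold conv; rewrite <- Cplus_sum_n; apply sum_n_ext; intros k; Cring.
Qed.

(** * Taylor coefficients of exponentials *)

Definition exp_coef (w : C) (n : nat) : C := w ^ n / RtoC (INR (fact n)).

Lemma RtoC_fact_neq_0 (n : nat) : RtoC (INR (fact n)) <> 0.
Proof. intros H; apply RtoC_inj in H; exact (INR_fact_neq_0 n H). Qed.

Lemma RtoC_fact_S (n : nat) :
  RtoC (INR (fact (S n))) = RtoC (INR (S n)) * RtoC (INR (fact n)).
Proof. now rewrite fact_simpl, mult_INR, RtoC_mult. Qed.

Lemma RtoC_INR_S_neq_0 (n : nat) : RtoC (INR (S n)) <> 0.
Proof. intros H; apply RtoC_inj in H; exact (not_0_INR (S n) ltac:(lia) H). Qed.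

Lemma exp_coef_S (w : C) (n : nat) :
  RtoC (INR (S n)) * exp_coef w (S n) = w * exp_coef w n.
Proof.
  unfold exp_coef; rewrite RtoC_fact_S, Cpow_S; Cfield.
  split; [apply RtoC_fact_neq_0 | apply RtoC_INR_S_neq_0].
Qed.

(* [a |-> (fun n => (n + 1) * a (n + 1))] is a derivation for [conv]. *)
Lemma conv_derive (a b : nat -> C) (n : nat) :
  RtoC (INR (S n)) * conv a b (S n)
  = conv (fun k => RtoC (INR (S k)) * a (S k)) b n
    + conv a (fun k => RtoC (INR (S k)) * b (S k)) n.
Proof.
  (* Split the weight [S n] as [k + (S n - k)]; the first sum then loses its term [k = 0] and the
     second its term [k = S n]. *)
  transitivity (sum_n (fun k => RtoC (INR k) * a k * b (S n - k)%nat) (S n)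
     + sum_n (fun k => a k * (RtoC (INR (S n - k)) * b (S n - k)%nat)) (S n)).
  - unfold conv; rewrite <- Cmult_sum_n_l, <- Cplus_sum_n.
    apply sum_n_ext_loc; intros k Hk.
    rewrite (minus_INR (S n) k Hk), RtoC_minus. Cring.
  - rewrite Csum_Sn_l, (Csum_Sn _ n), Nat.sub_diag. simpl (INR 0).
    unfold conv.
    rewrite (sum_n_ext_loc (fun k => a k * (RtoC (INR (S n - k)) * b (S n - k)%nat))
      (fun k => a k * (RtoC (INR (S (n - k))) * b (S (n - k))%nat)) n).
    2: { intros k Hk. now replace (S n - k)%nat with (S (n - k)) by lia. }
    simpl (S n - S _)%nat. Cring.
Qed.

(** By the Leibniz rule [conv_derive], both sides satisfy [(n + 1) e (n + 1) = (v + w) e n] with the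
    same initial value, so the binomial theorem is not invoked. *)
Lemma conv_exp_coef (v w : C) (n : nat) :
  conv (exp_coef v) (exp_coef w) n = exp_coef (v + w) n.
Proof.
  induction n as [|n IH].
  - unfold conv, exp_coef; rewrite sum_O; simpl; Cfield.
  - assert (H := exp_coef_S (v + w) n).
    assert (H' := conv_derive (exp_coef v) (exp_coef w) n).
    rewrite (conv_ext (fun k => RtoC (INR (S k)) * exp_coef v (S k))
      (fun k => v * exp_coef v k) _ (exp_coef w)) in H'
      by (intros; reflexivity || apply exp_coef_S).
    rewrite (conv_ext (exp_coef v) (exp_coef v)
      (fun k => RtoC (INR (S k)) * exp_coef w (S k)) (fun k => w * exp_coef w k)) in H'
      by (intros; reflexivity || apply exp_coef_S).
    assert (E : conv (fun k => v * exp_coef v k) (exp_coef w) n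
                + conv (exp_coef v) (fun k => w * exp_coef w k) n
                = (v + w) * conv (exp_coef v) (exp_coef w) n).
    { unfold conv; rewrite <- Cmult_sum_n_l, <- Cplus_sum_n.
      apply sum_n_ext; intros k; Cring. }
    rewrite E, IH, <- H in H'.
    assert (Hn := RtoC_INR_S_neq_0 n).
    rewrite <- (Cmult_1_l (conv _ _ _)), <- (Cmult_1_l (exp_coef _ (S n))).
    rewrite <- (Cinv_l _ Hn), <- !Cmult_assoc, H'. reflexivity.
Qed.

Definition kronecker0 (n : nat) : C := match n with O => 1 | S _ => 0 end.

Lemma conv_kronecker0 (a : nat -> C) (n : nat) : conv kronecker0 a n = a n.
Proof.
  destruct n as [|n]; unfold conv.
  - rewrite sum_O; simpl; ring.
  - rewrite Csum_Sn_l, (Cmult_sum_n_l 0 (fun k => a (S n - S k)%nat)).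
    simpl; ring.
Qed.

(** * Real power series and real parts of complex series *)

Lemma CV_radius_ge (a : nat -> R) (r l : R) :
  is_pseries a r l -> Rbar_le (Rabs r) (CV_radius a).
Proof.
  intros H. apply Rbar_not_lt_le; intros Hlt.
  (* Outside the disk the terms cannot tend to 0, yet those of a convergent series do. *)
  apply (CV_disk_outside a r Hlt).
  apply (is_lim_seq_ext (fun n => scal (pow_n r n) (a n))).
  - intros n. rewrite pow_n_pow. apply Rmult_comm.
  - apply ex_series_lim_0. exists l. exact H.
Qed.

Lemma Re_sum_n (a : nat -> C) (n : nat) :
  Re (sum_n a n) = sum_n (fun k => Re (a k)) n.
Proof.
  induction n as [|n IH].
  - now rewrite !sum_O.
  - rewrite Csum_Sn, sum_Sn, <- IH. reflexivity.
Qed.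

Lemma is_series_Re (a : nat -> C) (l : C) :
  @is_series C_AbsRing C_NormedModule a l ->
  is_series (fun n => Re (a n)) (Re l).
Proof.
  intros H. unfold is_series in *.
  apply (filterlim_ext (fun n => Re (sum_n a n)) (sum_n (fun n => Re (a n)))).
  - apply Re_sum_n.
  - apply (filterlim_comp _ _ _ (sum_n a) Re eventually (locally l)).
    + exact H.
    + destruct l as [p q]. exact (continuous_fst p q).
Qed.

(* For [n = 0] the truncated exponent [n - 1] is harmless, its factor being 0. *)
Lemma Derive_n_Re_affine_Cexp (x p q : C) (n : nat) (t : R) :
  Derive_n (fun t : R => Re ((p * t + q) * Cexp (x * t))) n t
  = Re ((x ^ n * (p * t + q) + RtoC (INR n) * x ^ (n - 1) * p) * Cexp (x * t)).
Proof.
  revert t; induction n as [|n IH]; intros t.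
  - change (Re ((p * t + q) * Cexp (x * t))
      = Re ((1 * (p * t + q) + 0 * x ^ (0 - 1) * p) * Cexp (x * t))).
    now replace (1 * (p * t + q) + 0 * x ^ (0 - 1) * p) with (p * t + q) by ring.
  - change (Derive (Derive_n (fun t : R => Re ((p * t + q) * Cexp (x * t))) n) t
      = Re ((x ^ S n * (p * t + q) + RtoC (INR (S n)) * x ^ (S n - 1) * p)
            * Cexp (x * t))).
    rewrite (Derive_ext _ _ _ IH).
    replace (RtoC (INR (S n)) * x ^ (S n - 1) * p)
      with (x ^ n * p + x * (RtoC (INR n) * x ^ (n - 1) * p)).
    2: { rewrite S_INR, RtoC_plus. destruct n as [|n].
         - simpl; ring.
         - replace (S (S n) - 1)%nat with (S n) by lia.
           replace (S n - 1)%nat with n by lia. rewrite Cpow_S; ring. }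
    rewrite Cpow_S.
    (* Naming the powers leaves an affine factor times [Cexp], which unfolds into real components
       that [auto_derive] can treat. *)
    set (u := x ^ n); set (v := RtoC (INR n) * x ^ (n - 1) * p).
    apply is_derive_unique.
    destruct x as [x1 x2], p as [p1 p2], q as [q1 q2], u as [u1 u2], v as [v1 v2].
    unfold Cexp, Cmult, Cplus, RtoC, Ci, Re, Im; simpl.
    auto_derive; [easy|].
    unfold Rminus; match goal with |- @eq _ ?a ?b => change (@eq R a b) end; ring.
Qed.

(** * The recurrence for Bernoulli polynomials *)

Lemma C_eq_of_Re_mult (a b : C) :
  (forall u : C, Re (u * a) = Re (u * b)) -> a = b.
Proof.
  intros H. assert (H1 := H 1). assert (H2 := H Ci).
  destruct a as [a1 a2], b as [b1 b2]; simpl in *.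
  f_equal; lra.
Qed.

Lemma Re_RtoC_mult (r : R) (c : C) : Re (RtoC r * c) = (r * Re c)%R.
Proof. destruct c; simpl; ring. Qed.

Lemma Cexp_RtoC (t : R) : Cexp (RtoC t) = RtoC (exp t).
Proof. unfold Cexp; simpl. rewrite cos_0, sin_0. ring. Qed.

(** The generating function cleared of its denominator, hence valid at the removable singularity
    too; elsewhere [exp t <> 1] by injectivity of the real exponential. *)
Lemma bernoulli_gf_RtoC (x : C) (t : R) :
  bernoulli_gf x t * RtoC (exp t) = bernoulli_gf x t + t * Cexp (x * t).
Proof.
  unfold bernoulli_gf. destruct (Ceq_dec (RtoC t) 0) as [E|E].
  - apply RtoC_inj in E; subst t. rewrite exp_0. ring.
  - rewrite Cexp_RtoC. field.
    intros H. apply (f_equal fst) in H. simpl in H.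
    apply E. f_equal. apply exp_inv. rewrite exp_0. lra.
Qed.

(* Coquelicot has Cauchy products and uniqueness of coefficients only for real
   power series, so the identity is proved for [z] real and for the real part of
   every complex multiple [u] of the coefficients. *)
Section Recurrence.

Context (B : nat -> C -> C) (hB : is_bernoulli_polynomials B) (x u : C).

Let b (n : nat) : R := Re (u * (B n x / RtoC (INR (fact n)))).
(** Coefficients of [(e^t - 1) Re (u * bernoulli_gf x t)], that is, of [Re (u t e^(x t))]. *)
Let c : nat -> R := PS_minus (PS_mult b (fun n => (/ INR (fact n))%R)) b.

Lemma is_pseries_bernoulli_Re (t : R) :
  (Rabs t < 2 * PI)%R -> is_pseries b t (Re (u * bernoulli_gf x t)).
Proof.
  intros Ht. unfold is_pseries.
  rewrite <- Cmod_R in Ht.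
  assert (H := is_series_Re _ _ (is_series_scal u _ _ (hB x t Ht))).
  refine (is_series_ext _ _ _ _ H); intros n.
  rewrite pow_n_pow. change (scal (t ^ n)%R (b n)) with (t ^ n * b n)%R.
  unfold b. rewrite <- Re_RtoC_mult, RtoC_pow. f_equal.
  change (u * (B n x * (RtoC t ^ n / RtoC (INR (fact n))))
    = RtoC t ^ n * (u * (B n x / RtoC (INR (fact n))))).
  field. apply RtoC_fact_neq_0.
Qed.

Lemma is_pseries_bernoulli_conv_Re (t : R) :
  (Rabs t < 1)%R -> is_pseries c t (Re ((u * t + 0) * Cexp (x * t))).
Proof.
  intros Ht. assert (HPI := PI2_1).
  assert (Hb := is_pseries_bernoulli_Re t ltac:(lra)).
  (* The Cauchy product needs [t] strictly inside both disks; convergence at 1, which is below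
     [2 * PI], ensures this. *)
  assert (R1 : Rbar_lt (Rabs t) (CV_radius b)).
  { apply Rbar_lt_le_trans with (Rabs 1).
    - rewrite Rabs_R1. exact Ht.
    - apply CV_radius_ge with (1 := is_pseries_bernoulli_Re 1 ltac:(rewrite Rabs_R1; lra)). }
  assert (R2 : Rbar_lt (Rabs t) (CV_radius (fun n => (/ INR (fact n))%R))).
  { apply Rbar_lt_le_trans with (Rabs 1).
    - rewrite Rabs_R1. exact Ht.
    - apply CV_radius_ge with (1 := is_exp_Reals 1). }
  assert (H := is_pseries_minus _ _ _ _ _
    (is_pseries_mult _ _ _ _ _ Hb (is_exp_Reals t) R1 R2) Hb).
  replace (Re ((u * t + 0) * Cexp (x * t)))
    with (plus (Re (u * bernoulli_gf x t) * exp t)%R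
            (opp (Re (u * bernoulli_gf x t)))); [exact H|].
  change ((Re (u * bernoulli_gf x t) * exp t - Re (u * bernoulli_gf x t))%R
    = Re ((u * t + 0) * Cexp (x * t))).
  rewrite (Rmult_comm _ (exp t)), <- Re_RtoC_mult.
  replace (RtoC (exp t) * (u * bernoulli_gf x t))
    with (u * (bernoulli_gf x t * RtoC (exp t))) by ring.
  rewrite bernoulli_gf_RtoC.
  replace (u * (bernoulli_gf x t + t * Cexp (x * t)))
    with (u * bernoulli_gf x t + (u * t + 0) * Cexp (x * t)) by ring.
  set (p := u * bernoulli_gf x t); set (q := (u * t + 0) * Cexp (x * t)).
  destruct p, q; simpl; ring.
Qed.

Lemma bernoulli_conv_coef_Re (n : nat) :
  (c n * INR (fact n))%R = Re (u * (RtoC (INR n) * x ^ (n - 1))).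
Proof.
  assert (Hc : Rbar_lt 0 (CV_radius c)).
  { apply Rbar_lt_le_trans with (Rabs (1 / 2)).
    - simpl. apply Rabs_pos_lt. lra.
    - apply CV_radius_ge with (1 := is_pseries_bernoulli_conv_Re (1 / 2)
        ltac:(rewrite Rabs_pos_eq; lra)). }
  (* [c n] times [n!] is the [n]-th derivative at 0 of the sum of the series, which near 0 is the
     affine-exponential function with [p = u] and [q = 0]. *)
  rewrite <- (Derive_n_coef c n Hc).
  rewrite (Derive_n_ext_loc _ (fun t : R => Re ((u * t + 0) * Cexp (x * t)))).
  - rewrite Derive_n_Re_affine_Cexp. f_equal.
    replace (x * 0) with (RtoC 0) by ring.
    rewrite Cexp_RtoC, exp_0. ring.
  - exists (mkposreal 1 Rlt_0_1). intros t Ht.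
    apply is_pseries_unique, is_pseries_bernoulli_conv_Re.
    change (Rabs (t - 0) < 1)%R in Ht. now rewrite Rminus_0_r in Ht.
Qed.

End Recurrence.

Lemma bernoulli_recurrence (B : nat -> C -> C) (x : C) (n : nat) :
  is_bernoulli_polynomials B ->
  conv (fun k => B k x / RtoC (INR (fact k))) (exp_coef 1) n
  = B n x / RtoC (INR (fact n)) + RtoC (INR n) * x ^ (n - 1) / RtoC (INR (fact n)).
Proof.
  intros hB. apply C_eq_of_Re_mult; intros u.
  assert (H := bernoulli_conv_coef_Re B hB x u n).
  assert (Hn := INR_fact_neq_0 n).
  transitivity (Re (u * (B n x / RtoC (INR (fact n))))
                + / INR (fact n) * Re (u * (RtoC (INR n) * x ^ (n - 1))))%R.
  - rewrite <- H. unfold PS_minus, PS_mult, conv.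
    rewrite <- Cmult_sum_n_l, Re_sum_n, <- sum_n_Reals.
    change (plus ?a (opp ?b)) with (a - b)%R.
    rewrite (sum_n_ext (fun k => Re (u * (B k x / RtoC (INR (fact k)) * exp_coef 1 (n - k))))
      (fun k => (Re (u * (B k x / RtoC (INR (fact k)))) * / INR (fact (n - k)))%R)).
    + match goal with |- context [sum_n ?f n] => set (S := sum_n f n : R) end.
      match goal with |- @eq _ ?p ?q => change (@eq R p q) end.
      field. exact Hn.
    + intros k. rewrite Rmult_comm, <- Re_RtoC_mult. f_equal.
      unfold exp_coef. rewrite Cpow_1_l, RtoC_inv by apply INR_fact_neq_0.
      field. split; apply RtoC_fact_neq_0.
  - rewrite <- Re_RtoC_mult, RtoC_inv by exact Hn.
    replace (u * (B n x / RtoC (INR (fact n)) + RtoC (INR n) * x ^ (n - 1) / RtoC (INR (fact n))))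
      with (u * (B n x / RtoC (INR (fact n)))
            + / RtoC (INR (fact n)) * (u * (RtoC (INR n) * x ^ (n - 1))))
      by (field; apply RtoC_fact_neq_0).
    reflexivity.
Qed.

(** In the recurrence at [n = 1] the two terms in [B 1 x] cancel. *)
Lemma bernoulli_0 (B : nat -> C -> C) (x : C) :
  is_bernoulli_polynomials B -> B O x = 1.
Proof.
  intros hB. assert (H := bernoulli_recurrence B x 1 hB).
  unfold conv in H. rewrite Csum_Sn, sum_O in H.
  unfold exp_coef in H; simpl in H.
  transitivity (B O x / 1 * (1 * 1 / 1) + B 1%nat x / 1 * (1 / 1) - B 1%nat x / 1);
    [field|].
  rewrite H. field.
Qed.

(** * The difference equation for exponential-Bernoulli convolutions *)

(* Taylor coefficients of [z |-> z e^(w z)]. *)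
Definition shifted_exp_coef (w : C) (n : nat) : C :=
  match n with O => 0 | S m => exp_coef w m end.

Lemma shifted_exp_coef_fact (w : C) (n : nat) :
  RtoC (INR (fact n)) * shifted_exp_coef w n = RtoC (INR n) * w ^ (n - 1).
Proof.
  destruct n as [|n].
  - simpl; ring.
  - unfold shifted_exp_coef, exp_coef. rewrite RtoC_fact_S.
    replace (S n - 1)%nat with n by lia. field. apply RtoC_fact_neq_0.
Qed.

Lemma conv_shifted_exp_coef (v w : C) (n : nat) :
  conv (exp_coef v) (shifted_exp_coef w) n = shifted_exp_coef (v + w) n.
Proof.
  rewrite conv_comm. destruct n as [|n]; unfold conv.
  - rewrite sum_O. simpl; ring.
  - rewrite Csum_Sn_l. simpl (shifted_exp_coef _ _).
    change (0 * exp_coef v (S n - 0) + conv (exp_coef w) (exp_coef v) n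
      = exp_coef (v + w) n).
    rewrite conv_comm, conv_exp_coef. ring.
Qed.

(** Taylor coefficients of [z |-> bernoulli_gf x (w * z)]. *)
Definition bernoulli_coef (B : nat -> C -> C) (x w : C) (n : nat) : C :=
  w ^ n * (B n x / RtoC (INR (fact n))).

Lemma conv_bernoulli_coef_exp_coef (B : nat -> C -> C) (x w : C) (n : nat) :
  is_bernoulli_polynomials B ->
  conv (bernoulli_coef B x w) (exp_coef w) n
  = bernoulli_coef B x w n + w * shifted_exp_coef (w * x) n.
Proof.
  intros hB.
  transitivity (w ^ n * conv (fun k => B k x / RtoC (INR (fact k))) (exp_coef 1) n).
  - unfold conv; rewrite <- Cmult_sum_n_l.
    apply sum_n_ext_loc; intros k Hk.
    unfold bernoulli_coef, exp_coef. rewrite Cpow_1_l.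
    replace (w ^ n) with (w ^ k * w ^ (n - k))
      by (rewrite <- Cpow_add_r; f_equal; lia).
    Cfield. split; apply RtoC_fact_neq_0.
  - rewrite bernoulli_recurrence by exact hB.
    unfold bernoulli_coef. rewrite Cmult_plus_distr_l. f_equal.
    assert (H := shifted_exp_coef_fact (w * x) n).
    assert (Hn := RtoC_fact_neq_0 n).
    assert (E : w * shifted_exp_coef (w * x) n
      = w * (RtoC (INR n) * (w * x) ^ (n - 1)) / RtoC (INR (fact n))).
    { rewrite <- H. field. exact Hn. }
    rewrite E, Cpow_mult_l. destruct n as [|n].
    + simpl; field.
    + replace (S n - 1)%nat with n by lia. rewrite Cpow_S. field. exact Hn.
Qed.

(** With [G] the generating function, [e^(wz) G(wz) = G(wz) + w z e^(wxz)]; multiply by [e^(tz)]. *)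
Lemma conv_exp_coef_bernoulli_difference (B : nat -> C -> C) (x w t : C) (n : nat) :
  is_bernoulli_polynomials B ->
  conv (exp_coef (t + w)) (bernoulli_coef B x w) n
  = conv (exp_coef t) (bernoulli_coef B x w) n
    + w * shifted_exp_coef (t + w * x) n.
Proof.
  intros hB.
  transitivity (conv (exp_coef t) (conv (exp_coef w) (bernoulli_coef B x w)) n).
  - rewrite <- conv_assoc. apply conv_ext; [|easy].
    intros k. now rewrite conv_exp_coef.
  - rewrite <- conv_shifted_exp_coef. unfold conv at 4.
    rewrite <- Cmult_sum_n_l.
    rewrite (conv_ext (exp_coef t) (exp_coef t) _
      (fun k => bernoulli_coef B x w k + w * shifted_exp_coef (w * x) k) n).
    + rewrite conv_plus_r. f_equal. apply sum_n_ext; intros k. Cring.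
    + easy.
    + intros k. rewrite conv_comm. now apply conv_bernoulli_coef_exp_coef.
Qed.

(** * Closed forms for balancing polynomials *)

Lemma balancing_SS (n : nat) (x : C) :
  balancing (S (S n)) x = 6 * x * balancing (S n) x - balancing n x.
Proof. reflexivity. Qed.

Lemma balancing_binet (x s : C) (hs : s ^ 2 = 9 * x ^ 2 - 1) (n : nat) :
  2 * s * balancing n x = (3 * x + s) ^ n - (3 * x - s) ^ n.
Proof.
  enough (H : 2 * s * balancing n x = (3 * x + s) ^ n - (3 * x - s) ^ n /\
    2 * s * balancing (S n) x = (3 * x + s) ^ S n - (3 * x - s) ^ S n)
    by apply H.
  induction n as [|n [IH0 IH1]].
  - split; simpl; ring.
  - split; [exact IH1|].
    rewrite balancing_SS.
    replace (2 * s * (6 * x * balancing (S n) x - balancing n x))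
      with (6 * x * (2 * s * balancing (S n) x) - 2 * s * balancing n x) by ring.
    rewrite IH0, IH1, !Cpow_S.
    set (p := (3 * x + s) ^ n); set (q := (3 * x - s) ^ n).
    (* Each of [3 * x + s] and [3 * x - s] is a root of [r^2 = 6 x r - 1] up to the defect
       [9 x^2 - 1 - s^2], which [hs] makes zero. *)
    transitivity ((3 * x + s) * (3 * x + s) * p - (3 * x - s) * (3 * x - s) * q
      + (9 * x ^ 2 - 1 - s ^ 2) * (p - q)); [ring|].
    rewrite hs. ring.
Qed.

Lemma balancing_even_degenerate (x : C) (hx : 9 * x ^ 2 = 1) (n : nat) :
  balancing (2 * n) x = 6 * RtoC (INR n) * x.
Proof.
  (* The three-term recurrence forces the odd-index values into the induction. *)
  enough (H : balancing (2 * n) x = 6 * RtoC (INR n) * x /\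
    balancing (S (2 * n)) x = 2 * RtoC (INR n) + 1) by apply H.
  induction n as [|n [IH0 IH1]].
  - split; simpl; ring.
  - replace (2 * S n)%nat with (S (S (2 * n))) by lia.
    rewrite S_INR, RtoC_plus.
    assert (E : balancing (S (S (2 * n))) x = 6 * (RtoC (INR n) + 1) * x).
    { rewrite balancing_SS, IH0, IH1. ring. }
    split; [exact E|].
    rewrite balancing_SS, E, IH1.
    transitivity (4 * (9 * x ^ 2) * (RtoC (INR n) + 1) - (2 * RtoC (INR n) + 1));
      [ring|]. rewrite hx. ring.
Qed.

(** * Assembling the identity *)

Lemma Cbinom_fact (n k : nat) :
  Cbinom n k = RtoC (INR (fact n))
    / (RtoC (INR (fact k)) * RtoC (INR (fact (n - k)))).
Proof.
  unfold Cbinom, Binomial.C.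
  rewrite RtoC_div, RtoC_mult; [reflexivity|].
  apply Rmult_integral_contrapositive_currified; apply INR_fact_neq_0.
Qed.

Theorem theorem6 (B : nat -> C -> C) (hB : is_bernoulli_polynomials B)
    (x s : C) (hs : s ^ 2 = 9 * x ^ 2 - 1) (n : nat) :
  sum_n (fun k : nat =>
           Cbinom n k * (12 * x * s) ^ (n - k)
             * balancing (2 * k) x * B (n - k)%nat x) n
  = 6 * RtoC (INR n) * x
      * (18 * x ^ 2 - 1 + 6 * x * (2 * x - 1) * s) ^ (n - 1).
Proof.
  set (w := 12 * x * s).
  set (beta := bernoulli_coef B x w).
  transitivity (RtoC (INR (fact n)) *
    conv (fun k => balancing (2 * k) x / RtoC (INR (fact k))) beta n).
  { unfold conv. rewrite <- Cmult_sum_n_l. apply sum_n_ext; intros k.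
    rewrite Cbinom_fact. unfold beta, bernoulli_coef.
    Cfield. split; apply RtoC_fact_neq_0. }
  destruct (Ceq_dec s 0) as [E|E].
  - assert (hx : 9 * x ^ 2 = 1).
    { transitivity (9 * x ^ 2 - 1 + 1); [ring|]. rewrite <- hs, E. simpl; ring. }
    assert (hw : w = 0) by (unfold w; rewrite E; ring).
    replace (18 * x ^ 2 - 1 + 6 * x * (2 * x - 1) * s) with (RtoC 1).
    2: { transitivity (2 * (9 * x ^ 2) - 1 + 6 * x * (2 * x - 1) * s); [|ring].
         rewrite hx, E; ring. }
    rewrite Cpow_1_l, Cmult_1_r, <- (balancing_even_degenerate x hx n).
    assert (Hconv : conv (fun k => balancing (2 * k) x / RtoC (INR (fact k))) beta n
      = balancing (2 * n) x / RtoC (INR (fact n))).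
    (* As [w = 0], only the constant coefficient of [beta] survives; it equals [B 0 x = 1], so
       [beta] is the unit of [conv]. *)
    { rewrite conv_comm.
      rewrite <- (conv_kronecker0 (fun k => balancing (2 * k) x / RtoC (INR (fact k)))).
      apply conv_ext; [|easy].
      intros k. unfold beta, bernoulli_coef. rewrite hw. destruct k as [|k].
      - rewrite bernoulli_0 by exact hB. simpl; field.
      - rewrite Cpow_S; simpl; ring. }
    rewrite Hconv. Cfield. apply RtoC_fact_neq_0.
  - set (a := 18 * x ^ 2 - 1 + 6 * x * s); set (b := 18 * x ^ 2 - 1 - 6 * x * s).
    assert (Ha : (3 * x + s) ^ 2 = a).
    { transitivity (9 * x ^ 2 + 6 * x * s + s ^ 2); [ring|].
      rewrite hs; unfold a; ring. }
    assert (Hb : (3 * x - s) ^ 2 = b).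
    { transitivity (9 * x ^ 2 - 6 * x * s + s ^ 2); [ring|].
      rewrite hs; unfold b; ring. }
    assert (Hbal : forall k, balancing (2 * k) x / RtoC (INR (fact k))
      = / (2 * s) * (exp_coef a k - exp_coef b k)).
    { intros k. assert (H := balancing_binet x s hs (2 * k)).
      rewrite !Cpow_mult_r, Ha, Hb in H.
      unfold exp_coef. transitivity (/ (2 * s) * (2 * s * balancing (2 * k) x)
        / RtoC (INR (fact k))).
      - field. split; [exact E | apply RtoC_fact_neq_0].
      - rewrite H. field. split; [apply RtoC_fact_neq_0 | exact E]. }
    rewrite (conv_ext _ _ beta beta n Hbal) by easy.
    transitivity (RtoC (INR (fact n)) * (/ (2 * s)
      * (conv (exp_coef a) beta n - conv (exp_coef b) beta n))).
    { f_equal. unfold conv, Cminus.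
      replace (- sum_n (fun k => exp_coef b k * beta (n - k)%nat) n)
        with ((-1) * sum_n (fun k => exp_coef b k * beta (n - k)%nat) n) by Cring.
      rewrite <- !Cmult_sum_n_l, <- Cplus_sum_n, <- Cmult_sum_n_l.
      apply sum_n_ext; intros k. Cring. }
    (* Here [a - b = 12 x s = w], so the difference equation applies with [t = b]. *)
    replace a with (b + w) by (unfold a, b, w; ring).
    unfold beta. rewrite conv_exp_coef_bernoulli_difference by exact hB.
    replace (b + w * x) with (18 * x ^ 2 - 1 + 6 * x * (2 * x - 1) * s)
      by (unfold b, w; ring).
    set (y := 18 * x ^ 2 - 1 + 6 * x * (2 * x - 1) * s).
    transitivity (6 * x * (RtoC (INR (fact n)) * shifted_exp_coef y n)).
    (* The prefactor is [w / (2 s) = 6 x]. *)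
    + unfold w. Cfield. exact E.
    + rewrite shifted_exp_coef_fact. Cring.
Qed.
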